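(* Let $(X,T)$ be a minimal Cantor system such that the infinitesimal subgroup $\mathrm{Inf}(K^0(X,T))$ of the dimension group $K^0(X,T)$ is trivial. Then the quotient group $I(X,T)/E(X,T)$ is torsion free.
   Context: A Cantor system $(X,T)$ is a homeomorphism $T:X\to X$ of a Cantor space $X$ (compact, metrizable, with a countable basis of clopen sets and no isolated points); it is minimal if $X$ contains no proper non-empty closed $T$-invariant subset. $\mathcal{M}(X,T)$ denotes the set of $T$-invariant Borel probability measures on $X$, and $C(X,\mathbb{Z})$ the group of continuous functions $X\to\mathbb{Z}$. $K^0(X,T)$ is the ordered group with order unit whose underlying group is $C(X,\mathbb{Z})/\{f\circ T-f : f\in C(X,\mathbb{Z})\}$, whose positive cone is the set of classes $[f]$ of non-negative functions $f\in C(X,\mathbb{Z})$, and whose order unit is the class $[1]$ of the constant function $1$. Its infinitesimal subgroup is $$\mathrm{Inf}(K^0(X,T))=\Big\{[f] : f\in C(X,\mathbb{Z}),\ \int f\,d\mu=0 \text{ for all }\mu\in\mathcal{M}(X,T)\Big\}.$$ The image subgroup is $$I(X,T)=\bigcap_{\mu\in\mathcal{M}(X,T)}\Big\{\int f\,d\mu : f\in C(X,\mathbb{Z})\Big\}\subseteq\mathbb{R}.$$ $E(X,T)$ is the additive group of all $\alpha\in\mathbb{R}$ such that $\exp(2i\pi\alpha)$ is a continuous eigenvalue of $(X,T)$, i.e. there is a continuous $f:X\to\mathbb{C}$, $f\neq 0$, with $f\circ T=\exp(2i\pi\alpha)f$. It is known that $E(X,T)$ is a subgroup of $I(X,T)$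 for every minimal Cantor system. *)

(* Defs.v *)
From HB Require Import structures.
From mathcomp Require Import all_boot all_order all_algebra.
From mathcomp Require Import all_classical all_reals all_analysis.
From mathcomp Require Import ring_quotient complex.

Set Implicit Arguments.
Unset Strict Implicit.
Unset Printing Implicit Defensive.

Import Order.TTheory GRing.Theory Num.Theory.
Import numFieldNormedType.Exports.

Local Open Scope classical_set_scope.
Local Open Scope ring_scope.

Definition homeomorphism (X Y : topologicalType) (f : X -> Y) : Prop :=
  continuous f /\
  exists g : Y -> X, [/\ continuous g, cancel f g & cancel g f].

Definition metrizable (R : realType) (X : topologicalType) : Prop :=
  exists (M : metricType R) (f : X -> M), homeomorphism f.

(* Nonemptiness of Cantor spaces is carried by the pointed type. *)
Definition is_cantor_space (R : realType) (X : ptopologicalType) : Prop :=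
  [/\ compact [set: X],
      metrizable R X,
      exists B : set (set X), [/\ countable B, B `<=` clopen & basis B] &
      isolated [set: X] = set0].

Definition is_minimal (X : topologicalType) (T : X -> X) : Prop :=
  forall A : set X, closed A -> T @` A = A -> A !=set0 -> A = [set: X].

Record minimalCantorSystem (R : realType) := MinimalCantorSystem {
  mcs_space :> ptopologicalType;
  mcs_map : mcs_space -> mcs_space;
  mcs_cantor : is_cantor_space R mcs_space;
  mcs_homeo : homeomorphism mcs_map;
  mcs_minimal : is_minimal mcs_map }.

Arguments mcs_map {R} m _.

Definition borel (X : ptopologicalType) : measurableType (@open X).-sigma :=
  g_sigma_algebraType (@open X).

Definition invariant_probabilities (R : realType) (X : ptopologicalType)
    (T : X -> X) : set (probability (borel X) R) :=
  [set mu | forall A : set (borel X), measurable A -> mu (T @^-1` A) = mu A].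

(* The group C(X, Z) under pointwise addition, with Z discrete. *)
Definition CZ (X : topologicalType) : Type :=
  continuousType X (discrete_topology int).

HB.instance Definition _ (X : topologicalType) := Choice.on (CZ X).

Definition CZfun (X : topologicalType) (f : CZ X) : X -> int :=
  f : continuousType X (discrete_topology int).

Section CZ_zmodule.
Variable X : topologicalType.
Implicit Types f g h : CZ X.

Lemma CZ_ext f g : CZfun f =1 CZfun g -> f = g.
Proof. by move=> fg; apply/continuousEP. Qed.

Lemma CZ_near f x : \forall y \near x, CZfun f y = CZfun f x.
Proof.
have /= := @cts_fun _ _ (f : continuousType X (discrete_topology int)) x.
move=> /(_ [set CZfun f x]); apply => /=.
by rewrite nbhs_principalE; apply/principal_filterP.
Qed.

Lemma CZ_near_continuous (u : X -> int) :
  (forall x, \forall y \near x, u y = u x) ->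
  continuous (u : X -> discrete_topology int).
Proof.
move=> nu x A /=; rewrite nbhs_principalE => /principal_filterP Aux.
by apply: filterS (nu x) => y /= ->.
Qed.

Lemma CZ_zero_subproof :
  continuous ((fun=> 0) : X -> discrete_topology int).
Proof. by apply: CZ_near_continuous => x; apply: nearW. Qed.

Lemma CZ_opp_subproof f :
  continuous ((fun x => - CZfun f x) : X -> discrete_topology int).
Proof.
by apply: CZ_near_continuous => x; apply: filterS (CZ_near f x) => y ->.
Qed.

Lemma CZ_add_subproof f g :
  continuous ((fun x => CZfun f x + CZfun g x) : X -> discrete_topology int).
Proof.
apply: CZ_near_continuous => x.
by apply: filterS2 (CZ_near f x) (CZ_near g x) => y -> ->.
Qed.

Definition CZ_zero : CZ X := mkcts CZ_zero_subproof.
Definition CZ_opp f : CZ X := mkcts (@CZ_opp_subproof f).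
Definition CZ_add f g : CZ X := mkcts (@CZ_add_subproof f g).

Fact CZ_addA : associative CZ_add.
Proof. by move=> f g h; apply: CZ_ext => x; exact: addrA. Qed.
Fact CZ_addC : commutative CZ_add.
Proof. by move=> f g; apply: CZ_ext => x; exact: addrC. Qed.
Fact CZ_add0 : left_id CZ_zero CZ_add.
Proof. by move=> f; apply: CZ_ext => x; exact: add0r. Qed.
Fact CZ_addN : left_inverse CZ_zero CZ_opp CZ_add.
Proof. by move=> f; apply: CZ_ext => x; exact: addNr. Qed.

HB.instance Definition _ :=
  GRing.isZmodule.Build (CZ X) CZ_addA CZ_addC CZ_add0 CZ_addN.

End CZ_zmodule.

Section CZ_integral.
Variables (R : realType) (X : ptopologicalType).
Variable mu : probability (borel X) R.

Definition CZ_integral (f : CZ X) : R := \int[mu]_x (CZfun f x)%:~R.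

Lemma CZ_integrable (f : CZ X) : compact [set: X] ->
  mu.-integrable [set: borel X]
    (EFin \o ((fun x => (CZfun f x)%:~R) : borel X -> R)).
Proof.
move=> cX; apply: measurable_bounded_integrable => //.
- by rewrite [ltLHS](@probability_setT _ _ _ mu) ltry.
- move=> _ B mB; rewrite setTI; apply: sub_sigma_algebra.
  change (@open X ((fun x => (CZfun f x)%:~R : R) @^-1` B)).
  rewrite openE => x /= Bx; apply: filterS (CZ_near f x) => y /= ->.
  exact: Bx.
- have cf : continuous (fun x : X => (CZfun f x)%:~R : R).
    move=> x A /= /nbhs_singleton Ax.
    by apply: filterS (CZ_near f x) => y /= ->.
  have := compact_bounded (continuous_compact (continuous_subspaceT cf) cX).
  case=> M [Mr HM]; exists M; split => // N MN x _.
  by apply: (HM N MN); exists x.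
Qed.

Lemma CZ_integral0 : CZ_integral 0 = 0.
Proof.
rewrite /CZ_integral (_ : (fun _ => _) = cst 0) ?Rintegral_cst ?mul0r //.
Qed.

Lemma CZ_integralB (f g : CZ X) : compact [set: X] ->
  CZ_integral (f - g) = CZ_integral f - CZ_integral g.
Proof.
move=> cX; rewrite /CZ_integral -RintegralB //; try exact: CZ_integrable.
by apply: eq_Rintegral => x _; rewrite -intrB.
Qed.

End CZ_integral.

Definition coboundary (X : topologicalType) (T : X -> X) : {pred CZ X} :=
  [pred g : CZ X |
    `[< exists f : CZ X, forall x, CZfun g x = CZfun f (T x) - CZfun f x >]].

Lemma coboundary_zmod_closed (X : topologicalType) (T : X -> X) :
  zmod_closed (coboundary T).
Proof.
split; first by apply/asboolP; exists 0 => x.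
move=> g1 g2 /asboolP[f1 E1] /asboolP[f2 E2]; apply/asboolP; exists (f1 - f2).
move=> x; change (CZfun g1 x - CZfun g2 x =
  (CZfun f1 (T x) - CZfun f2 (T x)) - (CZfun f1 x - CZfun f2 x)).
by rewrite E1 E2 !opprD !opprK addrACA.
Qed.

HB.instance Definition _ (X : topologicalType) (T : X -> X) :=
  GRing.isZmodClosed.Build (CZ X) (coboundary T) (coboundary_zmod_closed T).

(* The group underlying K^0(X, T); its positive cone and order unit play no
   role in the definition of the infinitesimal subgroup. *)
Definition K0 (X : topologicalType) (T : X -> X) : zmodType :=
  Quotient.quot (coboundary T : zmodClosed (CZ X)).

Definition K0_class (X : topologicalType) (T : X -> X) (f : CZ X) : K0 T :=
  (\pi_(Quotient.quot (coboundary T)) f)%qT.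

Definition Inf_K0 (R : realType) (X : ptopologicalType) (T : X -> X) :
    set (K0 T) :=
  [set K0_class T f | f in [set f : CZ X |
    forall mu, invariant_probabilities (R := R) T mu -> CZ_integral mu f = 0]].

Arguments Inf_K0 R {X} T _.

Definition image_subgroup (R : realType) (X : ptopologicalType) (T : X -> X) :
    set R :=
  \bigcap_(mu in invariant_probabilities T)
    [set CZ_integral mu f | f in [set: CZ X]].

Arguments image_subgroup R {X} T _.

(* exp (2 i pi a) *)
Definition expi2pi (R : realType) (a : R) : R[i] :=
  (cos (2 * pi * a) +i* sin (2 * pi * a))%C.

(* [R[i]^o] carries the topology of the modulus. *)
Definition eigen_subgroup (R : realType) (X : topologicalType) (T : X -> X) :
    set R :=
  [set a | exists f : X -> R[i]^o,
    [/\ continuous f, f <> cst 0 & forall x, f (T x) = expi2pi a * f x]].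

Arguments eigen_subgroup R {X} T _.

Lemma expi2pi0 (R : realType) : expi2pi (0 : R) = 1.
Proof. by rewrite /expi2pi mulr0 cos0 sin0. Qed.

Lemma expi2piB (R : realType) (a b : R) :
  expi2pi (a - b) = expi2pi a / expi2pi b.
Proof.
have e : expi2pi (a - b) * expi2pi b = expi2pi a.
  have -> : expi2pi a = expi2pi ((a - b) + b) by rewrite subrK.
  rewrite /expi2pi (mulrDr (2 * pi) (a - b) b) cosD sinD.
  by apply/eqP; rewrite eq_complex /= eqxx addrC eqxx.
rewrite -e mulfK // eq_complex /=; apply/negP => /andP[/eqP c0 /eqP s0].
have := cos2Dsin2 (2 * pi * b); rewrite c0 s0 expr0n /= addr0.
by move/eqP; rewrite eq_sym oner_eq0.
Qed.

Section minimal_cantor_groups.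
Variables (R : realType) (S : minimalCantorSystem R).
Local Notation T := (mcs_map S).

Lemma image_subgroup_zmod_closed :
  zmod_closed [pred a | a \in image_subgroup R T].
Proof.
have [cX _ _ _] := mcs_cantor S.
split=> [|a b]; first by apply/mem_set => mu _; exists 0 => //; exact: CZ_integral0.
rewrite !inE => Ia Ib mu Mmu.
have [f _ <-] := Ia mu Mmu; have [g _ <-] := Ib mu Mmu.
by exists (f - g) => //; exact: CZ_integralB.
Qed.

Lemma eigenfunction_neq0 (f : S -> R[i]^o) (a : R) :
  continuous f -> f <> cst 0 -> (forall x, f (T x) = expi2pi a * f x) ->
  forall x, f x != 0.
Proof.
move=> cf f0 fT x; apply/negP => /eqP fx0; apply: f0.
have [_ [T' [_ TK T'K]]] := mcs_homeo S.
have en0 : expi2pi a != 0.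
  apply/eqP => e0; have := expi2piB a a.
  by rewrite subrr expi2pi0 e0 mul0r => /eqP; rewrite oner_eq0.
suff fE : f @^-1` [set 0] = setT.
  by apply/funext => y; have : setT y by []; rewrite -fE.
apply: (mcs_minimal (m := S)); last by exists x.
  apply: (@preimage_closed _ _ f [set (0 : R[i]^o)]) => //.
  apply: accessible_closed_set1.
  exact: hausdorff_accessible (@norm_hausdorff _ _).
apply/seteqP; split=> [_ [y /= fy0 <-]|y /= fy0].
  by rewrite /= fT fy0 mulr0.
exists (T' y) => //=; apply: (mulfI en0).
by rewrite -fT T'K mulr0.
Qed.

Lemma eigen_subgroup_zmod_closed :
  zmod_closed [pred a | a \in eigen_subgroup R T].
Proof.
split=> [|a b].
  apply/mem_set; exists (cst 1); split; first by move=> x; exact: cvg_cst.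
    by move/(congr1 (@^~ point))/eqP; rewrite /cst oner_eq0.
  by move=> x; rewrite expi2pi0 mul1r.
rewrite !inE => -[f [cf f0 fT]] [g [cg g0 gT]].
have fn := eigenfunction_neq0 cf f0 fT; have gn := eigenfunction_neq0 cg g0 gT.
exists (fun x => f x / g x); split.
- move=> x; apply: (@cvgM (R[i]) S (nbhs x) _ f (fun y => (g y)^-1)); first exact: cf.
  by apply: cvgV; [exact: gn|exact: cg].
- move/(congr1 (@^~ point))/eqP.
  by rewrite mulf_eq0 invr_eq0 (negPf (fn _)) (negPf (gn _)).
- by move=> x; rewrite fT gT expi2piB invfM mulrACA.
Qed.

Definition image_pred : {pred R} := [pred a | a \in image_subgroup R T].

HB.instance Definition _ :=
  GRing.isZmodClosed.Build R image_pred image_subgroup_zmod_closed.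

Record image_group := ImageGroup {
  image_val :> R; image_valP : image_val \in image_pred }.

HB.instance Definition _ := [isSub for image_val].
HB.instance Definition _ := [Choice of image_group by <:].
HB.instance Definition _ := [SubChoice_isSubZmodule of image_group by <:].

(* E(X, T) as a subgroup of I(X, T). *)
Definition eigen_pred : {pred image_group} :=
  [pred a | image_val a \in eigen_subgroup R T].

Lemma eigen_pred_zmod_closed : zmod_closed eigen_pred.
Proof.
have [E0 EB] := eigen_subgroup_zmod_closed.
by split=> [|a b Ea Eb]; [exact: E0|exact: EB].
Qed.

HB.instance Definition _ :=
  GRing.isZmodClosed.Build image_group eigen_pred eigen_pred_zmod_closed.

Definition image_mod_eigen : zmodType :=
  Quotient.quot (eigen_pred : zmodClosed image_group).

End minimal_cantor_groups.

Arguments image_pred {R} S _.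
Arguments eigen_pred {R} S _.

Definition torsion_free (G : zmodType) : Prop :=
  forall (x : G) (n : nat), (0 < n)%N -> x *+ n = 0 -> x = 0.

(* Main.v *)
Require Import Defs.
From mathcomp Require Import all_boot all_order all_algebra.
From mathcomp Require Import all_classical all_reals all_analysis.
From mathcomp Require Import measurable_realfun complex.
From mathcomp Require Import finmap ring lra.

(** Let [a] be in I(X, T) with [n a] in E(X, T), [n > 0].  Everything rests on
    translating eigenvalues into cocycle equations over the reals.

    Since X is zero-dimensional, a continuous nonvanishing complex function
    [f] has a continuous real argument: [f = r exp (2 i pi F)] with [r > 0]
    ([continuous_argument]).  If [f \o T = exp (2 i pi b) f], comparing moduli
    and arguments shows that [F \o T - F - b] takes integer values, and
    conversely [exp (2 i pi F)] is an eigenfunction whenever that happens.  So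
    [b] is in E(X, T) exactly when [F \o T - F = b + h] for some real
    continuous [F] and some [h] in C(X, Z) ([eigen_subgroupP]); every
    invariant measure then gives [h] the integral [- b] ([cocycle_integral]).

    Apply this to [b = n a].  Suppose that a single [g] in C(X, Z) has
    integral [a] for all invariant measures at once.  Then [h + n g] is
    infinitesimal, hence, the infinitesimal subgroup being trivial, it equals
    [phi \o T - phi] with [phi] in C(X, Z).  Dividing by [n], the function
    [G = (F - phi) / n] satisfies [G \o T - G = a - g], so that [a] is in
    E(X, T) ([eigen_subgroup_divisible]).

    By definition, [a] in I(X, T) only gives one function for each measure.
    The uniform [g] ([image_subgroup_uniform]) comes from a generic invariant
    probability [mu]: one such that any [f] in C(X, Z) with [mu]-integral [a]
    has integral [a] against all invariant probabilities
    ([generic_invariant_probability]).  As C(X, Z) is countable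
    ([CZ_enumeration]), say equal to the [F n], choose for each [n] an
    invariant probability [mus n] which witnesses, if possible, that the
    integral of [F n] is not always [a]; then [mu] is a countable convex
    combination of the [mus n] whose weights are chosen one after the other so
    as to prevent accidental cancellations ([generic_weights]). *)

Set Implicit Arguments.
Unset Strict Implicit.
Unset Printing Implicit Defensive.

Import Order.TTheory GRing.Theory Num.Theory.
Import numFieldNormedType.Exports.

Local Open Scope classical_set_scope.
Local Open Scope ring_scope.

(** * Locally constant functions on a Cantor space *)

Definition clopen_base (X : topologicalType) (e : nat -> set X) : Prop :=
  (forall n, clopen (e n)) /\
  forall (x : X) (U : set X), nbhs x U -> exists2 n, e n x & e n `<=` U.

Lemma cantor_clopen_base (R : realType) (X : ptopologicalType) :
  is_cantor_space R X ->
  exists e : nat -> set X, clopen_base e.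
Proof.
case=> _ _ [B [cB Bc [_ bB]]] _.
have [U [BU _] _] := bB point _ filterT.
move/pfcard_geP: cB => [B0|[e]]; first by rewrite B0 in BU.
exists e; split=> [n|x V /bB[W [BW Wx] WV]]; first exact/Bc/funS.
have [n _ eW] := surj (f := e) BW.
by exists n; rewrite eW.
Qed.

Section first_match.
Variables (X : ptopologicalType) (e : nat -> set X).
Hypothesis be : clopen_base e.

(** Finite data describing an integer-valued function: overlapping clopen sets
    are made disjoint by giving priority to the first one of the list.  The
    lists form a countable type, whence the countability of C(X, Z). *)
Fixpoint first_match (s : seq (nat * int)) (x : X) : int :=
  if s is p :: s' then if `[< e p.1 x >] then p.2 else first_match s' x else 0.

Lemma first_match_near (s : seq (nat * int)) (x : X) :
  \forall y \near x, first_match s y = first_match s x.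
Proof.
elim: s => [|p s IH] /=; first exact: nearW.
have [oe cle] := be.1 p.1.
case: asboolP => ex.
  have : \forall y \near x, e p.1 y by apply: open_nbhs_nbhs.
  by apply: filterS => y ey; rewrite asboolT.
have : \forall y \near x, ~ e p.1 y.
  by apply: open_nbhs_nbhs; split => //; exact: closed_openC.
by apply: filterS2 IH => y -> ey; rewrite asboolF.
Qed.

(** Local choices of an integer label can be glued into a locally constant one:
    by compactness finitely many basic clopen sets, each carrying a label that
    is valid on all of it, cover the space.  Used both to enumerate C(X, Z) and
    to choose branches of the argument of a complex function. *)
Lemma first_match_select (P : X -> int -> Prop) : compact [set: X] ->
  (forall x : X, exists z, \forall y \near x, P y z) ->
  exists s, forall x, P x (first_match s x).
Proof.
rewrite compact_cover => cX locP.
pose D := [set p : nat * int | forall y, e p.1 y -> P y p.2].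
have [|x _|F FD Fcov] := cX _ D (fun p => e p.1).
- by move=> p _; case: (be.1 p.1).
- have [z /be.2[n enx eP]] := locP x.
  by exists (n, z).
exists (enum_fset F) => x.
have {FD} : forall p, p \in enum_fset F -> D p by move=> p pF; exact/set_mem/FD.
have {Fcov} : exists2 p, p \in enum_fset F & e p.1 x.
  by have [p pF px] := Fcov x I; exists p.
elim: (enum_fset F) => [[]//|q s IH] [p ps epx] sD /=.
case: asboolP => [eqx|neqx]; first by apply: (sD q) => //; rewrite mem_head.
apply: IH => [|r rs]; last by apply: sD; rewrite in_cons rs orbT.
move: ps; rewrite in_cons => /predU1P[pq|ps]; last by exists p.
by rewrite -pq in neqx.
Qed.

End first_match.

(** * Generic convex combinations *)

Section generic_weights.
Variables (R : realType) (a : nat -> nat -> R) (B : nat -> R).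
Hypothesis aB : forall n k, `|a n k| <= B n.

(** The state before step [k] is a budget, bounding the sum of all the weights
    still to be chosen, together with the partial sums
    [v n = \sum_(j < k) c_j a_(n, j)].  Of two admissible values for the next
    weight, at least one makes [v k] nonzero if [a k k] is nonzero. *)
Definition next_weight k (st : R * (nat -> R)) : R :=
  if st.2 k + st.1 / 2 * a k k == 0 then st.1 / 4 else st.1 / 2.

(** Once [v k] is nonzero, the budget is cut so that the later weights can
    change [v k] by at most half of its absolute value. *)
Definition weight_step k (st : R * (nat -> R)) : R * (nat -> R) :=
  let v := fun n => st.2 n + next_weight k st * a n k in
  (if v k == 0 then st.1 / 2
   else Num.min (st.1 / 2) (`|v k| / (2 * (1 + B k))), v).

Fixpoint weight_state k : R * (nat -> R) :=
  if k is k'.+1 then weight_step k' (weight_state k') else (1, fun=> 0).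

Let budget k := (weight_state k).1.
Let weight k := next_weight k (weight_state k).

Let B_ge0 n : 0 <= B n.
Proof. exact: le_trans (aB n 0). Qed.

Let budget_gt0 k : 0 < budget k.
Proof.
elim: k => [|k IH]; rewrite /budget /= ?ltr01//.
case: ifPn => [_|v0]; first by rewrite divr_gt0.
rewrite lt_min divr_gt0//= divr_gt0 ?normr_gt0// mulr_gt0//.
by rewrite ltr_pwDl.
Qed.

Let weight_gt0 k : 0 < weight k.
Proof.
by rewrite /weight /next_weight; case: ifP => _; rewrite divr_gt0 ?budget_gt0.
Qed.

Let weight_le k : weight k <= budget k - budget k.+1.
Proof.
have h1 : weight k <= budget k / 2.
  rewrite /weight /next_weight -/(budget k); case: ifP => // _.
  by have := budget_gt0 k; lra.
have h2 : budget k.+1 <= budget k / 2.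
  by rewrite /budget /=; case: ifP => // _; rewrite ge_min lexx.
lra.
Qed.

Let stateE n k : (weight_state k).2 n = series (fun j => weight j * a n j) k.
Proof.
elim: k => [|k IH]; first by rewrite /series /= big_geq.
by rewrite seriesS -IH /= addrC.
Qed.

(* Each weight is at most the decrease of the budget, so that sums telescope. *)
Let tail k N : (k <= N)%N ->
  series weight N - series weight k <= budget k - budget N.
Proof.
move=> kN; rewrite sub_series_geq//; elim: N kN => [|N IH].
  by rewrite leqn0 => /eqP ->; rewrite big_geq// subrr.
rewrite leq_eqVlt => /predU1P[->|]; first by rewrite big_geq// subrr.
rewrite ltnS => kN; rewrite big_nat_recr//=.
have := weight_le N; have := IH kN; lra.
Qed.

Let weight_sum_gt0 : exists2 C : R, 0 < C & series weight @ \oo --> C.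
Proof.
have nd : nondecreasing_seq (series weight).
  by apply: nondecreasing_series => i _ _; exact: ltW.
have cv : cvgn (series weight).
  apply: nondecreasing_is_cvgn => //; exists 1 => _ [N _ <-].
  have := tail (leq0n N); have := budget_gt0 N.
  have -> : series weight 0 = 0 by rewrite /series /= big_geq.
  have -> : budget 0 = 1 by [].
  lra.
exists (limn (series weight)) => //.
apply: lt_le_trans (nondecreasing_cvgn_le nd cv 1%N).
by rewrite /series /= big_nat1.
Qed.

Let weight_generic n :
  series (fun k => weight k * a n k) @ \oo --> (0 : R) -> a n n = 0.
Proof.
move=> cv0; apply/eqP; apply: contraT => an0.
set s := series _ in cv0.
have sn0 : s n.+1 != 0.
  rewrite /s seriesS -stateE /weight /next_weight addrC.
  case: ifP => [/eqP h|/negbT//].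
  apply/eqP => h'; have : (weight_state n).1 * a n n = 0 by lra.
  by apply/eqP; rewrite mulf_neq0// gt_eqF// budget_gt0.
have bud : budget n.+1 * B n <= `|s n.+1| / 2.
  have : budget n.+1 <= `|s n.+1| / (2 * (1 + B n)).
    move: sn0; rewrite /s -stateE /budget /= => /negPf ->.
    by rewrite ge_min lexx orbT.
  have B1 : 0 < 1 + B n by rewrite ltr_pwDl.
  rewrite ler_pdivlMr ?mulr_gt0//.
  have := budget_gt0 n.+1; have := B_ge0 n; nra.
have far N : (n.+1 <= N)%N -> `|s n.+1| / 2 <= `|s N|.
  move=> nN; have : `|s N - s n.+1| <= budget n.+1 * B n.
    rewrite /s sub_series_geq//.
    apply: le_trans (ler_norm_sum _ _ _) _.
    apply: (@le_trans _ _ (\sum_(n.+1 <= k < N) weight k * B n)).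
      apply: ler_sum => k _; rewrite normrM gtr0_norm//.
      by apply: ler_wpM2l; [exact: ltW|exact: aB].
    rewrite -mulr_suml ler_wpM2r// -sub_series_geq//.
    by have := tail nN; have := budget_gt0 N; lra.
  have := lerB_dist (s n.+1) (s n.+1 - s N).
  rewrite subKr distrC; lra.
have : `|s n.+1| / 2 <= `|0 : R|.
  apply: (cvgr_to_ge (cvg_norm cv0)).
  by exists n.+1 => // N /= nN; exact: far.
have : 0 < `|s n.+1| by rewrite normr_gt0.
rewrite normr0; lra.
Qed.

(** Each equation [\sum_k c_k a_(n, k) = 0] with [a_(n, n)] nonzero excludes a
    hyperplane of weights, and countably many hyperplanes can be avoided
    simultaneously.  The budgets make the weights summable; dividing by their
    sum preserves the vanishing or not of the row sums. *)
Lemma generic_weights : exists c : nat -> R,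
  [/\ forall k, 0 <= c k, series c @ \oo --> (1 : R) &
      forall n, series (fun k => c k * a n k) @ \oo --> (0 : R) -> a n n = 0].
Proof.
have [C C0 cvC] := weight_sum_gt0.
exists (fun k => C^-1 * weight k); split.
- by move=> k; rewrite mulr_ge0 ?invr_ge0 ?ltW.
- rewrite -(mulVf (lt0r_neq0 C0)).
  rewrite (_ : series _ = fun N => C^-1 * series weight N); last first.
    by apply/funext => N; rewrite /series /= mulr_sumr.
  exact: cvgM (cvg_cst _) cvC.
- move=> n cv; apply: weight_generic.
  rewrite (_ : series _ =
    fun N => C * series (fun k => C^-1 * weight k * a n k) N); last first.
    apply/funext => N; rewrite /series /= mulr_sumr.
    by apply: eq_bigr => k _; rewrite !mulrA divff ?mul1r// lt0r_neq0.
  by rewrite -(mulr0 C); exact: cvgM (cvg_cst _) cv.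
Qed.

End generic_weights.

Section bounded_integrals.
Context d (T : measurableType d) (R : realType).
Implicit Types (mu : probability T R) (f : T -> R).

Lemma bounded_probability_integrable mu f (M : R) :
  measurable_fun setT f -> (forall x, `|f x| <= M) ->
  mu.-integrable setT (EFin \o f).
Proof.
move=> mf fM; apply: measurable_bounded_integrable => //.
  by rewrite [ltLHS](@probability_setT _ _ _ mu) ltry.
exists M; split; first exact: num_real.
by move=> N MN x _; exact: le_trans (fM x) (ltW MN).
Qed.

Lemma Rintegral_probability_cst mu (M : R) : \int[mu]_x M = M.
Proof. by rewrite Rintegral_cst// (congr1 fine (probability_setT mu)) mulr1. Qed.

Lemma Rintegral_addr_cst mu f (M : R) :
  mu.-integrable setT (EFin \o f) ->
  \int[mu]_x (f x + M) = \int[mu]_x f x + M.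
Proof.
move=> fi; rewrite RintegralD//; last exact: finite_measure_integrable_cst.
by rewrite Rintegral_probability_cst.
Qed.

Lemma normr_Rintegral_le mu f (M : R) :
  measurable_fun setT f -> (forall x, `|f x| <= M) ->
  `|\int[mu]_x f x| <= M.
Proof.
move=> mf fM; have fi := bounded_probability_integrable mu mf fM.
apply: le_trans (le_normr_Rintegral _ fi) _ => //.
have -> : M = \int[mu]_(x in setT) M.
  by rewrite Rintegral_probability_cst.
apply: le_Rintegral => //; last exact: finite_measure_integrable_cst.
exact: integrable_norm.
Qed.

(** For a countable convex combination of probabilities, the integral is the sum
    of the integrals.  The bound [M] reduces this to the nonnegative function
    [f + M], for which it holds by monotone convergence. *)
Lemma probability_mixture (c : nat -> R) (mus : nat -> probability T R) :
  (forall k, 0 <= c k) -> series c @ \oo --> (1 : R) ->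
  exists mu : probability T R,
    (forall A, mu A = \sum_(k <oo) ((c k)%:E * mus k A))%E /\
    forall f (M : R), measurable_fun setT f -> (forall x, `|f x| <= M) ->
      series (fun k => c k * \int[mus k]_x f x) @ \oo --> \int[mu]_x f x.
Proof.
move=> c0 c1.
pose m_ k : {measure set T -> \bar R} := mscale (NngNum (c0 k)) (mus k).
pose m : {measure set T -> \bar R} := mseries m_ 0.
have mE A : (m A = \sum_(k <oo) ((c k)%:E * mus k A))%E by [].
have m1 : m setT = 1%:E.
  rewrite mE; apply/cvg_lim => //.
  rewrite (_ : (fun _ => _) = EFin \o series c).
    by apply: cvg_EFin; [exact: nearW|exact: c1].
  apply/funext => n; rewrite /series /= -sumEFin.
  by apply: eq_bigr => k _; rewrite probability_setT mule1.
(* As [m] has mass 1, normalizing it only serves to get a probability. *)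
pose mu : probability T R := mnormalize m (mus 0).
have muE A : mu A = m A.
  rewrite /mu /= /mnormalize (m1 : m setT = 1%:E) /=.
  by rewrite [X in (_ || X)%E](_ : _ = false)// onee_eq0 /= invr1 mule1.
exists mu; split=> [A|f M mf fM]; first by rewrite muE mE.
have fi nu := bounded_probability_integrable nu mf fM.
have fM0 x : 0 <= f x + M by have := fM x; rewrite ler_norml; lra.
have mfM : measurable_fun setT (fun x => f x + M).
  by apply: measurable_funD => //; exact: measurable_cst.
have EI (nu : probability T R) :
    (\int[nu]_x (f x + M)%:E)%E = (\int[nu]_x f x + M)%:E.
  rewrite -Rintegral_addr_cst// /Rintegral fineK//.
  apply: integrable_fin_num => //.
  have cM := finite_measure_integrable_cst nu M (@measurableT _ T).
  exact: (integrableD measurableT (fi nu) cM).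
have cvM : series (fun k => c k * (\int[mus k]_x f x + M)) @ \oo -->
    \int[mu]_x f x + M.
  suff : (EFin \o series (fun k => c k * (\int[mus k]_x f x + M))) @ \oo -->
      (\int[mu]_x f x + M)%:E by move/fine_cvgP => [].
  rewrite -EI.
  rewrite (eq_measure_integral m); last by move=> A _ _; exact: muE.
  rewrite ge0_integral_measure_series//; last 2 first.
  - by move=> x _; rewrite lee_fin.
  - exact/measurable_EFinP.
  rewrite (_ : _ \o _ = fun n => (\sum_(0 <= k < n) \int[m_ k]_x (f x + M)%:E)%E).
    apply: is_cvg_ereal_nneg_natsum => k _.
    by apply: integral_ge0 => x _; rewrite lee_fin.
  apply/funext => n; rewrite /series /= -sumEFin; apply: eq_bigr => k _.
  rewrite EFinM -EI; apply/esym; apply: ge0_integral_mscale => //.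
    exact/measurable_EFinP.
  by move=> x _; rewrite lee_fin.
rewrite (_ : series _ = fun n => series (fun k =>
    c k * (\int[mus k]_x f x + M)) n - series c n * M).
  have := cvgB cvM (cvgM c1 (cvg_cst M)); rewrite mul1r addrK; exact.
apply/funext => n.
rewrite /series /= mulr_suml -sumrB; apply: eq_bigr => k _; ring.
Qed.

End bounded_integrals.

(** * Invariant probabilities and the image subgroup *)

Section continuous_on_compact.
Variables (R : realType) (X : ptopologicalType).

Lemma continuous_borel_measurable (f : X -> R) : continuous f ->
  measurable_fun [set: borel X] (f : borel X -> R).
Proof.
move=> cf; apply: (measurability _ (RGenOpens.measurableE R)).
move=> _ [_ [a [b ->]] <-]; rewrite setTI; apply: sub_sigma_algebra.
change (@open X (f @^-1` `]a, b[%classic)).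
by apply: open_comp => [x _|]; [exact: cf|exact: interval_open].
Qed.

Lemma compact_continuous_bounded (f : X -> R) :
  compact [set: X] -> continuous f -> exists M : R, forall x, `|f x| <= M.
Proof.
move=> cX cf.
have := compact_bounded (continuous_compact (continuous_subspaceT cf) cX).
case=> M [Mr HM]; exists (M + 1) => x.
by apply: (HM (M + 1)); [rewrite ltrDl|exists x].
Qed.

Lemma CZ_continuous_real (f : CZ X) :
  continuous (fun x => (CZfun f x)%:~R : R).
Proof.
move=> x A /= /nbhs_singleton Ax.
by apply: filterS (CZ_near f x) => y /= ->.
Qed.

End continuous_on_compact.

Section invariant_measures.
Variables (R : realType) (S : minimalCantorSystem R).
Local Notation T := (mcs_map S).
Local Notation inv_prob := (invariant_probabilities (R := R) T).

Lemma CZ_enumeration : exists F : nat -> CZ S, forall f, exists n, F n = f.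
Proof.
have [e be] := cantor_clopen_base (mcs_cantor S).
have [cS _ _ _] := mcs_cantor S.
pose fm s : CZ S :=
  mkcts (CZ_near_continuous (fun x => first_match_near be s x)).
exists (fun n => fm (odflt [::] (choice.unpickle n))) => f.
have [|s sf] := first_match_select be (P := fun x z => z = CZfun f x) cS.
  by move=> x; exists (CZfun f x); apply: filterS (CZ_near f x) => y ->.
by exists (choice.pickle s); rewrite choice.pickleK /=; apply: CZ_ext => x; exact: sf.
Qed.

(** Each function of the enumeration whose integral is not always [a] gets a
    witness, and the weights of the mixture keep the integral of each such
    function away from [a]. *)
Lemma generic_invariant_probability (a : R) : inv_prob !=set0 ->
  exists2 mu, inv_prob mu & forall f : CZ S, CZ_integral mu f = a ->
    forall nu, inv_prob nu -> CZ_integral nu f = a.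
Proof.
case=> mu0 inv0; have [F Fsurj] := CZ_enumeration.
have [cS _ _ _] := mcs_cantor S.
have /choice[mus musP] n : exists mu, inv_prob mu /\
    (CZ_integral mu (F n) = a ->
     forall nu, inv_prob nu -> CZ_integral nu (F n) = a).
  have [allF|/existsNP[nu /not_implyP[invnu nua]]] :=
    pselect (forall nu, inv_prob nu -> CZ_integral nu (F n) = a).
  - by exists mu0.
  - by exists nu.
have mF n := continuous_borel_measurable (@CZ_continuous_real R _ (F n)).
have /choice[M MF] n : exists M : R, forall x, `|(CZfun (F n) x)%:~R| <= M.
  exact: compact_continuous_bounded cS (@CZ_continuous_real R _ (F n)).
have aB n k : `|CZ_integral (mus k) (F n) - a| <= M n + `|a|.
  apply: le_trans (ler_normB _ _) _; rewrite lerD2r.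
  by apply: normr_Rintegral_le => //; exact: MF.
have [c [c0 c1 cgen]] := generic_weights aB.
have [mu [muE muint]] := probability_mixture mus c0 c1.
exists mu => [A mA|f].
  rewrite !muE; apply: eq_eseriesr => k _.
  by rewrite (musP k).1.
have [n <-] := Fsurj f => mua; apply: (musP n).2; apply/eqP.
rewrite -subr_eq0; apply/eqP; apply: cgen.
rewrite (_ : series _ = fun N => series (fun k =>
    c k * CZ_integral (mus k) (F n)) N - series c N * a).
  have := cvgB (muint _ _ (mF n) (MF n)) (cvgM c1 (cvg_cst a)).
  rewrite -/(CZ_integral mu (F n)) mua mul1r subrr; exact.
apply/funext => N; rewrite /series /= mulr_suml -sumrB.
by apply: eq_bigr => k _; rewrite mulrBr.
Qed.

(** A function whose integral against the generic probability is [a] has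
    integral [a] against all the others. *)
Lemma image_subgroup_uniform (a : R) : image_subgroup R T a ->
  exists g : CZ S, forall mu, inv_prob mu -> CZ_integral mu g = a.
Proof.
move=> Ia; have [inv0|/set0P[mu0 inv0]] := eqVneq inv_prob set0.
  by exists 0 => mu; rewrite inv0.
have [|mu invmu mugen] := generic_invariant_probability a; first by exists mu0.
have [g _ ga] := Ia mu invmu.
by exists g; exact: mugen.
Qed.

Lemma integral_comp_invariant mu (F : S -> R) : inv_prob mu -> continuous F ->
  \int[mu]_x F (T x) = \int[mu]_x F x.
Proof.
move=> invmu cF; have [cS _ _ _] := mcs_cantor S.
have [cT _] := mcs_homeo S.
have mT : measurable_fun [set: borel S] (T : borel S -> borel S).
  apply: (@measurability _ _ (borel S) (borel S) setT T (@open S)) => //.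
  move=> _ [U oU <-].
  rewrite setTI; apply: sub_sigma_algebra.
  by change (@open S (T @^-1` U)); apply: open_comp => // x _; exact: cT.
have cFT : continuous (F \o T) by move=> x; apply: continuous_comp; [exact: cT|exact: cF].
have [M FM] := compact_continuous_bounded cS cFT.
have iFT := bounded_probability_integrable mu (continuous_borel_measurable cFT) FM.
have mF : measurable_fun [set: borel S] (EFin \o (F : borel S -> R)).
  by apply/measurable_EFinP; exact: continuous_borel_measurable.
have := integral_pushforward mT mF iFT measurableT.
rewrite (eq_measure_integral mu) => [|A mA _]; last exact: invmu.
by rewrite /Rintegral preimage_setT => ->.
Qed.

End invariant_measures.

(** * Continuous arguments of complex functions *)

Section complex_argument.
Variable R : realType.
Implicit Types (z : R[i]) (a b : R).

Lemma expi2piD a b : expi2pi (a + b) = expi2pi a * expi2pi b.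
Proof.
rewrite /expi2pi mulrDr cosD sinD.
by apply/eqP; rewrite eq_complex /= eqxx addrC eqxx.
Qed.

Lemma normC_expi2pi a : `|expi2pi a| = 1.
Proof. by rewrite normc_def /= cos2Dsin2 sqrtr1. Qed.

Lemma expi2pi_neq0 a : expi2pi a != 0.
Proof. by rewrite -normr_eq0 normC_expi2pi oner_eq0. Qed.

Lemma expi2piMz a (q : int) : expi2pi (q%:~R * a) = expi2pi a ^ q.
Proof.
have nat_case (n : nat) : expi2pi (n%:R * a) = expi2pi a ^+ n.
  elim: n => [|n IH]; first by rewrite mul0r expi2pi0.
  by rewrite -addn1 natrD mulrDl mul1r expi2piD IH exprD expr1.
case: q => n; first exact: nat_case.
by rewrite NegzE mulrNz mulNr -[- (_ * _)]sub0r expi2piB expi2pi0 nat_case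
  mul1r -exprnN.
Qed.

Lemma expi2pi1 : expi2pi (1 : R) = 1.
Proof.
by rewrite /expi2pi mulr1 mulrC mulr_natr cos2pi sin2pi.
Qed.

Lemma expi2pi_quarter : expi2pi (4^-1 : R) = 'i%C.
Proof.
rewrite /expi2pi (_ : 2 * pi * 4^-1 = pi / 2); last by field.
by rewrite cos_pihalf sin_pihalf.
Qed.

Lemma expi2pi_eq1_half b : 0 <= b <= 2^-1 -> expi2pi b = 1 -> b = 0.
Proof.
move=> /andP[b0 b2] [cb _].
have pi0 : 0 < pi :> R := pi_gt0 R.
have : 2 * pi * b = 0.
  apply: cos_inj; rewrite ?cos0 ?in_itv//= ?lexx ?pi_ge0//.
  by apply/andP; split; nra.
by move/eqP; rewrite mulf_eq0 gt_eqF ?mulr_gt0//= => /eqP.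
Qed.

(** With [b] the fractional part of [a], either [b] or [1 - b] lies in the half
    period on which the cosine is injective. *)
Lemma expi2pi_eq1 a : expi2pi a = 1 -> exists q : int, a = q%:~R.
Proof.
move=> ea; exists (Num.floor a); apply/eqP; rewrite -subr_eq0; apply/eqP.
set b := a - _.
have eb : expi2pi b = 1.
  by rewrite expi2piB ea -[_%:~R]mulr1 expi2piMz expi2pi1 exp1rz divr1.
have b0 : 0 <= b by rewrite subr_ge0 ge_floor.
have b1 : b < 1 by rewrite ltrBlDr addrC -intrD1 floorD1_gt.
have [b2|b2] := leP b 2^-1; first by apply: expi2pi_eq1_half; rewrite ?b0.
have : 1 - b = 0.
  apply: expi2pi_eq1_half; last by rewrite expi2piB expi2pi1 eb divr1.
  apply/andP; split; lra.
lra.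
Qed.

(** The argument, counted in turns, on the right half-plane. *)
Definition right_arg z : R := atan (complex.Im z / complex.Re z) / (2 * pi).

Lemma right_argE z : 0 < complex.Re z ->
  exists2 r : R, 0 < r & z = r%:C%C * expi2pi (right_arg z).
Proof.
case: z => x y /= x0; rewrite /right_arg /=.
set th := atan _.
have cth : 0 < cos th by apply: cos_gt0_pihalf; rewrite atan_gtNpi2 atan_ltpi2.
have tth : sin th / cos th = y / x by have := atanK (y / x); rewrite /tan.
exists (x / cos th); first exact: divr_gt0.
rewrite /expi2pi (_ : 2 * pi * (th / (2 * pi)) = th); last first.
  by rewrite mulrC divfK// gt_eqF// mulr_gt0// pi_gt0.
apply/eqP; rewrite eq_complex /=; apply/andP; split; apply/eqP.
  by rewrite mul0r subr0 divfK// gt_eqF.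
rewrite mul0r addr0 -mulrA [X in _ * X]mulrC tth mulrC divfK// gt_eqF//.
Qed.

End complex_argument.

Section complex_continuity.
Variable R : realType.

Lemma Re_continuous : continuous (@complex.Re R : R[i]^o -> R).
Proof.
move=> z.
apply/(@cvgrPdist_lt R R^o _ _ (nbhs_filter (z : R[i]^o))) => e e0.
have e0' : 0 < e%:C%C :> R[i] by rewrite ltcR.
have := nbhsx_ballx (z : R[i]^o) e%:C%C e0'.
apply: filterS => w; rewrite -ball_normE /= => zw; rewrite -ltcR; apply: le_lt_trans zw.
by rewrite -raddfB; exact: normc_ge_Re.
Qed.

Lemma real_complex_continuous : continuous (real_complex R : R -> R[i]^o).
Proof.
move=> x; apply/cvgrPdist_lt => -[e e'].
rewrite ltcE /= => /andP[/eqP -> e0].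
have := nbhsx_ballx x e e0.
apply: filterS => y; rewrite -ball_normE /= => xy.
by rewrite -rmorphB normc_def /= expr0n /= addr0 sqrtr_sqr ltcR.
Qed.

Lemma expi2pi_continuous : continuous (@expi2pi R : R -> R[i]^o).
Proof.
have -> : @expi2pi R = fun a =>
    real_complex R (cos (2 * pi * a)) + 'i%C * real_complex R (sin (2 * pi * a)).
  apply/funext => a; apply/eqP; rewrite eq_complex /=.
  by rewrite !mul0r !mul1r !(mulr0, subr0, add0r, addr0) !eqxx.
have turn : continuous (fun b : R => 2 * pi * b).
  by move=> a; apply: cvgM; [exact: cvg_cst|exact: cvg_id].
have turn_comp (u : R -> R) : continuous u ->
    continuous (fun a => real_complex R (u (2 * pi * a)) : R[i]^o).
  move=> cu a; apply: (@continuous_comp _ _ _ (fun b => u (2 * pi * b))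
    (real_complex R : R -> R[i]^o)); last exact: real_complex_continuous.
  by apply: continuous_comp; [exact: turn|exact: cu].
move=> a; apply: (@cvgD _ (R[i]^o)).
  exact: (turn_comp _ (@continuous_cos R)).
apply: (@cvgM (R[i])); first exact: cvg_cst.
exact: (turn_comp _ (@continuous_sin R)).
Qed.

Lemma mulC_continuous (u : R[i]) : continuous (fun w : R[i]^o => u * w : R[i]^o).
Proof.
move=> z; apply: (@cvgM (R[i]) (R[i]^o) (nbhs z) (nbhs_filter z) (fun=> u) id).
  exact: cvg_cst.
exact: cvg_id.
Qed.

Lemma Im_continuous : continuous (@complex.Im R : R[i]^o -> R).
Proof.
have -> : @complex.Im R = @complex.Re R \o (fun w : R[i] => - 'i%C * w).
  by apply/funext => -[x y] /=; rewrite oppr0 mul0r sub0r mulN1r opprK.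
move=> z; apply: (@continuous_comp _ _ _ (fun w : R[i]^o => - 'i%C * w : R[i]^o)).
  exact: mulC_continuous.
exact: Re_continuous.
Qed.

Lemma right_arg_continuous (z : R[i]^o) : 0 < complex.Re z ->
  {for z, continuous (@right_arg R : R[i]^o -> R)}.
Proof.
move=> z0.
apply: (@cvgM R (R[i]^o) (nbhs z) (nbhs_filter z)
  (fun w => atan (complex.Im w / complex.Re w)) (fun=> _)); last exact: cvg_cst.
apply: (@continuous_comp _ _ _
  (fun w : R[i]^o => complex.Im w / complex.Re w) (@atan R));
  last exact: continuous_atan.
apply: (@cvgM R (R[i]^o) (nbhs z) (nbhs_filter z) (@complex.Im R)
  (fun w => (complex.Re w)^-1)); first exact: Im_continuous.
apply: (@cvgV R (R[i]^o) (nbhs z) (nbhs_filter z)); last exact: Re_continuous.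
by apply: lt0r_neq0.
Qed.

Lemma ex_quadrant (z : R[i]) : z != 0 ->
  exists q : int, 0 < complex.Re (z * 'i%C ^ (- q)).
Proof.
case: z => x y; rewrite eq_complex /= negb_and.
have [x0 _|x0 _|-> /=] := ltrgt0P x.
- by exists 0; rewrite oppr0 expr0z mulr1.
- exists (-2); rewrite opprK -exprnP expr2 /=.
  by rewrite !(mulr0, mul0r, mulr1, mul1r, subr0, addr0, sub0r, add0r)
    mulrN1 oppr_gt0.
rewrite ?eqxx /=; have [y0 _|y0 _|//] := ltrgt0P y.
- exists 1; rewrite exprN1.
  have -> : 'i%C^-1 = - 'i%C :> R[i].
    by apply: mulr1_eq; rewrite mulrN -expr2 sqr_i opprK.
  by rewrite /= mul0r mulrN1 opprK add0r.
- exists (-1); rewrite opprK expr1z /=.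
  by rewrite mul0r mulr1 sub0r oppr_gt0.
Qed.

End complex_continuity.

(** Every value [f x] is brought into the right half-plane by a number [q x] of
    quarter turns that can be chosen locally constant in [x]; the argument of
    the turned value is then given by the arctangent. *)
Lemma continuous_argument (R : realType) (X : ptopologicalType) (e : nat -> set X)
    (f : X -> R[i]^o) :
  compact [set: X] -> clopen_base e ->
  continuous f -> (forall x, f x != 0) ->
  exists2 F : X -> R, continuous F &
    forall x, exists2 r : R, 0 < r & f x = r%:C%C * expi2pi (F x).
Proof.
move=> cX be cf f0.
pose turned (q : int) (x : X) : R[i]^o := 'i%C ^ (- q) * f x.
have cturned q : continuous (turned q).
  move=> x; apply: (@continuous_comp _ _ _ f
    (fun w : R[i]^o => 'i%C ^ (- q) * w : R[i]^o)); first exact: cf.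
  exact: mulC_continuous.
have [|s sP] := first_match_select be
    (P := fun x q => 0 < complex.Re (turned q x)) cX.
  move=> x; have [q q0] := ex_quadrant (f0 x); exists q.
  rewrite mulrC in q0.
  have cRe : {for x, continuous (fun y => complex.Re (turned q y))}.
    apply: (@continuous_comp _ _ _ (turned q) (@complex.Re R)).
      exact: cturned.
    exact: Re_continuous.
  exact: (cvgr_gt _ cRe).
(* The [q] quarter turns taken out of [f x] are put back into the argument. *)
exists (fun x => right_arg (turned (first_match e s x) x) +
                 (first_match e s x)%:~R * 4^-1).
  move=> x; set q := first_match e s x.
  have near_q : \forall y \near x, right_arg (turned q y) + q%:~R * 4^-1 =
      right_arg (turned (first_match e s y) y) + (first_match e s y)%:~R * 4^-1.
    by apply: filterS (first_match_near be s x) => y ->.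
  apply: cvg_trans (near_eq_cvg near_q) _.
  apply: cvgD; last exact: cvg_cst.
  apply: (@continuous_comp _ _ _ (turned q) (@right_arg R)).
    exact: cturned.
  by apply: right_arg_continuous; exact: sP.
move=> x; set q := first_match e s x.
have [r r0 E] := right_argE (sP x); exists r => //.
rewrite expi2piD mulrA -E expi2piMz expi2pi_quarter /turned -/q mulrAC.
by rewrite -expfzDr ?addNr ?expr0z ?mul1r// neq0Ci.
Qed.

Lemma pi_quot_eq0 (V : zmodType) (I : zmodClosed V) (x : V) :
  (\pi_(Quotient.quot I)%qT x == 0) = (x \in I).
Proof.
have -> : 0 = \pi_(Quotient.quot I)%qT 0 by rewrite raddf0.
by rewrite -Quotient.idealrBE subr0.
Qed.

(** * Eigenvalues as cocycle equations *)

Section eigenvalues.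
Variables (R : realType) (S : minimalCantorSystem R).
Local Notation T := (mcs_map S).

Lemma integer_valued_CZ (k : S -> R) : continuous k ->
  (forall x, exists q : int, k x = q%:~R) ->
  exists h : CZ S, forall x, k x = (CZfun h x)%:~R.
Proof.
move=> ck /choice[h hE].
suff hlc x : \forall y \near x, h y = h x.
  by exists (mkcts (CZ_near_continuous hlc)).
have := ck x; move/cvgrPdist_lt => /(_ 1 ltr01).
apply: filterS => y; rewrite !hE -intrB -intr_norm ltrz1.
by rewrite -[1%R]add0r ltzD1 normr_le0 subr_eq0 => /eqP.
Qed.

(** In terms of an argument [F] of the eigenfunction, the eigenvalue equation
    says that [F \o T - F] is [a] modulo the integers, and the integer part of
    the equation is a continuous function. *)
Lemma eigen_subgroupP (a : R) : eigen_subgroup R T a <->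
  exists (F : S -> R) (h : CZ S), continuous F /\
    forall x, F (T x) - F x = a + (CZfun h x)%:~R.
Proof.
have [cS _ _ _] := mcs_cantor S; have [cT _] := mcs_homeo S.
split=> [[f [cf f0 fT]]|[F [h [cF FT]]]].
  have [e be] := cantor_clopen_base (mcs_cantor S).
  have [F cF FE] := continuous_argument cS be cf (eigenfunction_neq0 cf f0 fT).
  have ck : continuous (fun x => F (T x) - F x - a).
    move=> x; apply: cvgB; last exact: cvg_cst.
    apply: cvgB; last exact: cF.
    by apply: continuous_comp; [exact: cT|exact: cF].
  (* [F (T x) - F x - a] is an integer since its exponential is 1, the moduli
     of [f (T x)] and [f x] being equal. *)
  have [|h hE] := integer_valued_CZ ck.
    move=> x; apply: expi2pi_eq1.
    have [r r0 fx] := FE x; have [r' r'0 fTx] := FE (T x).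
    have E : r'%:C%C * expi2pi (F (T x)) = r%:C%C * (expi2pi a * expi2pi (F x)).
      by rewrite -fTx fT fx mulrCA.
    have rr : r' = r.
      have := congr1 (fun z : R[i] => `|z|) E.
      rewrite !normrM !normC_expi2pi !mulr1 !ger0_norm ?lecR ?ltW//.
      by case.
    rewrite rr in E; have {}E : expi2pi (F (T x)) = expi2pi a * expi2pi (F x).
      by apply: mulfI E; rewrite eq_complex /= gt_eqF.
    by rewrite !expi2piB E mulfK ?divff// expi2pi_neq0.
  exists F, h; split=> // x; rewrite -hE; ring.
exists (@expi2pi R \o F); split.
- move=> x; apply: continuous_comp; [exact: cF|exact: expi2pi_continuous].
- move/(congr1 (@^~ point))/(congr1 (fun z : R[i] => `|z|)).
  by rewrite /= normC_expi2pi normr0 => /eqP; rewrite oner_eq0.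
- move=> x; rewrite /= -expi2piD.
  have -> : F (T x) = a + F x + (CZfun h x)%:~R by have := FT x; lra.
  by rewrite expi2piD -[_%:~R]mulr1 expi2piMz expi2pi1 exp1rz mulr1.
Qed.

(** Invariance makes the integral of [F \o T - F] vanish. *)
Lemma cocycle_integral (a : R) (F : S -> R) (h : CZ S) mu :
  invariant_probabilities T mu -> continuous F ->
  (forall x, F (T x) - F x = a + (CZfun h x)%:~R) -> CZ_integral mu h = - a.
Proof.
move=> invmu cF FT; have [cS _ _ _] := mcs_cantor S; have [cT _] := mcs_homeo S.
have integrable_cont (G : S -> R) : continuous G ->
    mu.-integrable [set: borel S] (EFin \o (G : borel S -> R)).
  move=> cG; have [M GM] := compact_continuous_bounded cS cG.
  exact: (bounded_probability_integrable mu (continuous_borel_measurable cG) GM).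
have cFT : continuous (F \o T).
  by move=> x; apply: continuous_comp; [exact: cT|exact: cF].
have : \int[mu]_x (F (T x) - F x) = 0.
  rewrite RintegralB//; [|exact: integrable_cont..].
  by rewrite integral_comp_invariant// subrr.
under eq_Rintegral do rewrite FT addrC.
rewrite Rintegral_addr_cst; last exact: CZ_integrable.
by move/eqP; rewrite addr_eq0 => /eqP.
Qed.

Lemma infinitesimal_coboundary (f : CZ S) : Inf_K0 R T = [set 0] ->
  (forall mu, invariant_probabilities (R := R) T mu -> CZ_integral mu f = 0) ->
  exists phi : CZ S, forall x, CZfun f x = CZfun phi (T x) - CZfun phi x.
Proof.
move=> Inf0 f0.
have : Inf_K0 R T (K0_class T f) by exists f.
by rewrite Inf0 => /eqP; rewrite pi_quot_eq0 => /asboolP.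
Qed.

Lemma CZfunMn (g : CZ S) n x : CZfun (g *+ n) x = CZfun g x *+ n.
Proof.
elim: n => [//|n IH]; rewrite !mulrS -IH //.
Qed.

Lemma CZ_integralD mu (f g : CZ S) :
  CZ_integral (R := R) mu (f + g) = CZ_integral mu f + CZ_integral mu g.
Proof.
have [cS _ _ _] := mcs_cantor S.
by apply/eqP; rewrite -subr_eq -CZ_integralB// addrK.
Qed.

Lemma CZ_integralMn mu (g : CZ S) n :
  CZ_integral (R := R) mu (g *+ n) = CZ_integral mu g *+ n.
Proof.
elim: n => [|n IH]; first exact: CZ_integral0.
by rewrite !mulrS CZ_integralD IH.
Qed.

(** The cocycle equation for [n a] can be divided by [n] after correcting its
    solution by the integer-valued [phi] whose coboundary is the infinitesimal
    function [h + n g]: this turns the integer part of the equation into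
    [- n g]. *)
Lemma eigen_subgroup_divisible (a : R) (n : nat) : Inf_K0 R T = [set 0] ->
  (0 < n)%N -> image_subgroup R T a -> eigen_subgroup R T (a *+ n) ->
  eigen_subgroup R T a.
Proof.
move=> Inf0 n0 Ia /eigen_subgroupP[F [h [cF FT]]].
have [g ga] := image_subgroup_uniform Ia.
have [|phi phiE] := infinitesimal_coboundary (f := h + g *+ n) Inf0.
  move=> mu invmu; rewrite CZ_integralD CZ_integralMn.
  by rewrite (cocycle_integral invmu cF FT) ga// addNr.
have phiE' x : CZfun h x + CZfun g x *+ n = CZfun phi (T x) - CZfun phi x.
  by rewrite -phiE -CZfunMn.
apply/eigen_subgroupP.
exists (fun x => (F x - (CZfun phi x)%:~R) / n%:R), (- g); split.
  move=> x; apply: cvgM; last exact: cvg_cst.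
  by apply: cvgB; [exact: cF|exact: CZ_continuous_real].
move=> x; rewrite (_ : CZfun (- g) x = - CZfun g x)//.
have phiR : (CZfun h x)%:~R + (CZfun g x)%:~R * n%:R =
    (CZfun phi (T x))%:~R - (CZfun phi x)%:~R :> R.
  by rewrite -intrB -phiE' intrD rmorphMn /= mulr_natr.
have FTx : F (T x) - F x = a * n%:R + (CZfun h x)%:~R.
  by rewrite FT mulr_natr.
have nz : n%:R != 0 :> R by rewrite pnatr_eq0 -lt0n.
apply: (mulIf nz); rewrite -mulrBl divfK// mulrDl mulrNz mulNr; lra.
Qed.

End eigenvalues.

Theorem theorem1 (R : realType) (S : minimalCantorSystem R)
  (hInf : Inf_K0 R (mcs_map S) = [set 0]) :
  torsion_free (image_mod_eigen S).
Proof.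
move=> x n n0; elim/quotW: x => a.
rewrite -raddfMn => /eqP; rewrite pi_quot_eq0 => an.
apply/eqP; rewrite pi_quot_eq0; apply/mem_set.
apply: (eigen_subgroup_divisible hInf n0); first exact/set_mem/image_valP.
by rewrite -(raddfMn (val : image_group S -> R)); exact/set_mem.
Qed.
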